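(* Let $\sigma_1, \sigma_2 : A$ be finite innocent strategies with $\mathrm{Pos}(\sigma_1) = \mathrm{Pos}(\sigma_2)$. Then $\sigma_1$ and $\sigma_2$ have the same P-views of maximal length.
   Context: An arena is $A=(|A|,\le_A,\lambda_A)$ where $(|A|,\le_A)$ is a partial order and $\lambda_A:|A|\to\{-,+\}$ such that: each $[a]_A$ is finite; if $a_1,a_2\le_A a$ then they are comparable; if $a_1\prec_A a_2$ then $\lambda_A(a_1)\neq\lambda_A(a_2)$; minimal moves are negative. Here $a_1\prec_A a_2$ means $a_1<_A a_2$ with no event strictly in between. A play on $A$ is a string of moves, each possibly pointing to an earlier move, such that if $s_i$ points to $s_j$ then $s_j\prec_A s_i$, polarities alternate, and each non-minimal move has a pointer; it is well-opened if it has exactly one initial move. A strategy is a non-empty, even-length-prefix-closed, deterministic set of even-length plays. P-views: $\ulcorner si\urcorner=i$ for $i$ minimal; $\ulcorner s n^- m^+\urcorner=\ulcorner sn\urcorner m$ if the pointer of $m$ is in $\ulcorner sn\urcorner$; $\ulcorner s n^+ t m^-\urcorner=\ulcorner sn\urcorner m$ if $m$ points to $n$; undefined otherwise. $\sigma$ is innocent if all P-views of its plays' prefixes are defined and whenever $sab,t\in\sigma$, $ta$ is a play with $\ulcorner sa\urcorner=\ulcorner ta\urcorner$, then $tab\in\sigma$ (with $b$ pointing so that $\ulcorner sab\urcorner=\ulcorner tab\urcorner$); finite if $\{\ulcorner s\urcorner\mid s\in\sigma\}$ is finite. A configuration of $A$ is a finite tree $(|x|,\le_x)$ with $\partial_x:|x|\to|A|$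 respecting minimality and with $a_1\prec_x a_2\Rightarrow\partial_x(a_1)\prec_A\partial_x(a_2)$; isomorphisms are $\partial$-preserving bijections preserving and reflecting immediate causality; positions are isomorphism classes. The desequentialization of a well-opened play $s_1\dots s_n$ has events $\{1,\dots,n\}$, $\partial(i)=s_i$, $i\le j$ iff there is a chain of pointers from $s_j$ to $s_i$. $\mathrm{Pos}(\sigma)$ is the set of positions of desequentializations of well-opened plays of $\sigma$. *)

(* Defs.v *)
From HB Require Import structures.
From mathcomp Require Import all_boot all_order.
From mathcomp Require Import boolp classical_sets functions cardinality.

Set Implicit Arguments.
Unset Strict Implicit.
Unset Printing Implicit Defensive.

Import Order.TTheory.
Local Open Scope classical_set_scope.

Section OrderNotions.
Context {d : Order.disp_t} {T : porderType d}.
Implicit Types x y z : T.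

Definition minimal x := forall y, (y <= x)%O -> y = x.

(* Immediate causality [x \prec y]. *)
Definition covers x y := (x < y)%O /\ ~ exists z, (x < z < y)%O.

End OrderNotions.

Definition forestial d (T : porderType d) :=
  forall x y z : T, (x <= z)%O -> (y <= z)%O -> (x >=< y)%O.

Definition is_tree d (T : porderType d) :=
  (exists r : T, forall x, (r <= x)%O) /\ forestial T.

(* Polarity is boolean: [pos a] means [lambda a = +]. *)
Record arena := Arena {
  arena_disp : Order.disp_t;
  move :> porderType arena_disp;
  pos : move -> bool;
  arena_finitary : forall a : move, finite_set [set b : move | (b <= a)%O];
  arena_forestial : forestial move;
  arena_alternating : forall a1 a2 : move, covers a1 a2 -> pos a1 != pos a2;
  arena_negative : forall a : move, minimal a -> ~~ pos a
}.

(* A string of moves with pointers: the optional index is the (0-based)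
   position, in the whole string, of the move pointed to. *)
Definition pstring (A : arena) := seq (A * option nat).

Section Plays.
Context {A : arena}.
Implicit Types s t v : pstring A.

Definition is_play s :=
  [/\ (forall i a p, onth s i = Some (a, Some p) ->
         (p < i)%N /\ exists m, onth s p = Some m /\ covers m.1 a),
      (forall i a, onth s i = Some (a, None) -> minimal a)
    & sorted (fun m n : A * option nat => pos m.1 != pos n.1) s].

Definition well_opened s :=
  exists! i : nat, exists m, onth s i = Some m /\ minimal m.1.

(* [view s k o]: the P-view of the prefix [take k s] is defined and consists
   of the moves of [s] at the indices listed in [o]. *)
Inductive view s : nat -> seq nat -> Prop :=
| view_nil : view s 0 [::]
| view_init k m :
    onth s k = Some m -> minimal m.1 -> view s k.+1 [:: k]
| view_player k n m p o :
    onth s k = Some n -> ~~ pos n.1 ->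
    onth s k.+1 = Some (m, Some p) -> pos m ->
    view s k.+1 o -> p \in o -> view s k.+2 (rcons o k.+1)
| view_opponent k n m p o :
    onth s k = Some (m, Some p) -> ~~ pos m ->
    (p < k)%N -> onth s p = Some n -> pos n.1 ->
    view s p.+1 o -> view s k.+1 (rcons o k).

(* The pointing string carried by the indices [o] of [s]; pointers are
   renumbered to positions in the extracted string. *)
Definition extract s (o : seq nat) : pstring A :=
  pmap (fun i => omap (fun m => (m.1, omap (index^~ o) m.2)) (onth s i)) o.

(* The P-view of [s] is defined and equal to [v]. *)
Definition pview s v := exists2 o, view s (size s) o & v = extract s o.

Definition same_pview s t := exists v, pview s v /\ pview t v.

End Plays.

Record strategy (A : arena) := Strategy {
  plays : set (pstring A);
  strategy_play : forall s, plays s -> is_play s;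
  strategy_even : forall s, plays s -> ~~ odd (size s);
  strategy_nonempty : plays !=set0;
  strategy_prefix :
    forall s t, ~~ odd (size s) -> plays (s ++ t) -> plays s;
  strategy_deterministic :
    forall s a b b', plays (s ++ [:: a; b]) -> plays (s ++ [:: a; b']) ->
      b = b'
}.

Section Strategies.
Context {A : arena}.
Implicit Types sigma : strategy A.

Definition innocent sigma :=
  (forall s k, plays sigma s -> exists v, pview (take k s) v) /\
  (forall (s t : pstring A) (a b : A) (pa pb pa' : option nat),
     plays sigma (s ++ [:: (a, pa); (b, pb)]) -> plays sigma t ->
     is_play (t ++ [:: (a, pa')]) ->
     same_pview (s ++ [:: (a, pa)]) (t ++ [:: (a, pa')]) ->
     exists pb', plays sigma (t ++ [:: (a, pa'); (b, pb')]) /\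
       same_pview (s ++ [:: (a, pa); (b, pb)]) (t ++ [:: (a, pa'); (b, pb')])).

Definition pviews sigma : set (pstring A) :=
  [set v | exists2 s, plays sigma s & pview s v].

Definition finite_strategy sigma := finite_set (pviews sigma).

Definition longest_pviews sigma : set (pstring A) :=
  [set v | pviews sigma v /\
           forall w, pviews sigma w -> (size w <= size v)%N].

End Strategies.

Record config (A : arena) := Config {
  config_disp : Order.disp_t;
  event :> finPOrderType config_disp;
  label : event -> A;
  config_tree : is_tree event;
  config_minimal : forall e : event, minimal e <-> minimal (label e);
  config_causal :
    forall e1 e2 : event, covers e1 e2 -> covers (label e1) (label e2)
}.

Definition config_iso (A : arena) (x y : config A) :=
  exists f : x -> y,
    [/\ bijective f, forall e, label (f e) = label e
      & forall e1 e2, covers e1 e2 <-> covers (f e1) (f e2)].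

(* The isomorphism class of [x]; a plain predicate because [config A] lives in
   a universe too large for [set]. *)
Definition position (A : arena) (x : config A) : config A -> Prop :=
  fun y => config_iso x y.

(* Desequentialization. The condition [i < j] is automatic in a play; it makes
   the reachability preorder of the pointers an order for every string. *)
Definition occurrence (A : arena) (s : pstring A) : Type := 'I_(size s).

Section Desequentialization.
Context {A : arena} (s : pstring A).
Local Notation E := (occurrence s).

HB.instance Definition _ := Finite.on E.

Definition occ_label (i : E) : A := (tnth (in_tuple s) i).1.

Definition points_to (j i : E) : bool :=
  ((tnth (in_tuple s) j).2 == Some (nat_of_ord i)) &&
  (nat_of_ord i < nat_of_ord j)%N.

Definition occ_le (i j : E) : bool := connect points_to j i.

Lemma occ_le_leq i j : occ_le i j -> (nat_of_ord i <= nat_of_ord j)%N.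
Proof.
move=> /connectP[p]; elim: p j => [|k p IH] j /=; first by move=> _ ->.
by case/andP=> /andP[_ kj] /IH h /h ik; apply: leq_trans ik (ltnW kj).
Qed.

Lemma occ_le_refl : reflexive occ_le.
Proof. by move=> i; exact: connect0. Qed.

Lemma occ_le_anti : antisymmetric occ_le.
Proof.
move=> i j /andP[/occ_le_leq ij /occ_le_leq ji].
by apply/val_inj/eqP; rewrite eqn_leq; apply/andP; split.
Qed.

Lemma occ_le_trans : transitive occ_le.
Proof. by move=> j i k ij jk; exact: connect_trans jk ij. Qed.

Fact occ_display : Order.disp_t. Proof. exact: Order.Disp tt tt. Qed.

HB.instance Definition _ :=
  Order.Le_isPOrder.Build occ_display E occ_le_refl occ_le_anti occ_le_trans.

Lemma occ_leE (i j : E) : (i <= j)%O = occ_le i j.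
Proof. by []. Qed.

Lemma occ_lt_ltn (i j : E) : (i < j)%O -> (nat_of_ord i < nat_of_ord j)%N.
Proof.
rewrite lt_neqAle => /andP[ne /occ_le_leq le_ij].
by rewrite ltn_neqAle le_ij andbT.
Qed.

Lemma points_to_fun i j k : points_to i j -> points_to i k -> j = k.
Proof.
by move=> /andP[/eqP + _] /andP[/eqP + _] => -> [] /val_inj.
Qed.

Lemma points_to_lt i j : points_to j i -> (i < j)%O.
Proof.
move=> ji; rewrite lt_neqAle occ_leE /occ_le connect1 // andbT.
by case/andP: ji => _; rewrite ltn_neqAle => /andP[].
Qed.

(* An event strictly above another lies above the target of its pointer. *)
Lemma occ_lt_pred i j : (i < j)%O -> exists2 k, points_to j k & (i <= k)%O.
Proof.
rewrite lt_neqAle => /andP[ne /connectP[[|k p] /=]].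
  by move=> _ e; rewrite e eqxx in ne.
by case/andP=> jk kp e; exists k => //; apply/connectP; exists p.
Qed.

Lemma occ_forestial : forestial E.
Proof.
move=> i j k; have [n] := ubnP (nat_of_ord k).
elim: n k => // n IH k le_kn ik jk.
have [->|nik] := eqVneq i k; first by rewrite /Order.comparable jk orbT.
have [->|njk] := eqVneq j k; first by rewrite /Order.comparable ik.
have ltik : (i < k)%O by rewrite lt_neqAle nik.
have ltjk : (j < k)%O by rewrite lt_neqAle njk.
have [l kl il] := occ_lt_pred ltik.
have [l' kl' jl] := occ_lt_pred ltjk.
rewrite -(points_to_fun kl kl') in jl.
by apply: (IH l) => //; apply: leq_trans (occ_lt_ltn (points_to_lt kl)) _.
Qed.

Lemma onth_occ (i : E) : onth s (nat_of_ord i) = Some (tnth (in_tuple s) i).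
Proof.
have := ltn_ord i; rewrite -onthTE; case si: (onth s _) => [m|//] _.
by rewrite (tnth_nth m) /= (onth_nth _ _ _ _ si).
Qed.

Hypothesis play_s : is_play s.

Lemma occ_covers (i j : E) : covers i j -> points_to j i.
Proof.
case=> /[dup] ltij /occ_lt_pred[k jk]; rewrite le_eqVlt => /predU1P[-> //|ltik].
by case; exists k; rewrite ltik points_to_lt.
Qed.

Lemma points_to_covers (i j : E) :
  points_to j i -> covers (occ_label i) (occ_label j).
Proof.
case/andP=> /eqP ej _; have [ptr _ _] := play_s.
have := onth_occ j; rewrite /occ_label.
case: (tnth _ j) ej => a p /= -> /ptr[_ [m []]].
by rewrite onth_occ => -[->].
Qed.

Lemma occ_causal (i j : E) :
  covers i j -> covers (occ_label i) (occ_label j).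
Proof. by move/occ_covers/points_to_covers. Qed.

Lemma occ_minimal (i : E) : minimal i <-> minimal (occ_label i).
Proof.
split=> [mini | mini j].
  have [ptr init _] := play_s; have := onth_occ i; rewrite /occ_label.
  case ei: (tnth _ i) => [a [p|]]; last exact: init.
  case/ptr=> lt_pi _.
  have pi : points_to i (Ordinal (ltn_trans lt_pi (ltn_ord i))).
    by rewrite /points_to ei /= eqxx.
  have /mini e := ltW (points_to_lt pi).
  by have := points_to_lt pi; rewrite e ltxx.
rewrite le_eqVlt => /predU1P[//|/occ_lt_pred[k /points_to_covers[lt_ki _] _]].
by have := ltW lt_ki; move/mini => e; rewrite e ltxx in lt_ki.
Qed.

Lemma occ_tree : well_opened s -> is_tree E.
Proof.
case=> r [[m [sr minm]] uniqr]; split; last exact: occ_forestial.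
have ltr : (r < size s)%N by rewrite -onthTE sr.
exists (Ordinal ltr) => i; have [n] := ubnP (nat_of_ord i).
elim: n i => // n IH i lt_in.
have [mini|nmini] := pselect (minimal i).
  suff -> : i = Ordinal ltr by [].
  apply/val_inj/esym/uniqr; exists (tnth (in_tuple s) i).
  by split; [exact: onth_occ | exact/occ_minimal].
have [j] : exists j, (j < i)%O.
  apply: contrapT => h; apply: nmini => j; rewrite le_eqVlt => /predU1P[//|ji].
  by case: h; exists j.
case/occ_lt_pred=> k /points_to_lt ik _; apply: le_trans (ltW ik).
by apply: IH; apply: leq_trans (occ_lt_ltn ik) _.
Qed.

End Desequentialization.

Definition deseq (A : arena) (s : pstring A) (hs : is_play s)
    (wo : well_opened s) : config A :=
  Config (occ_tree hs wo) (occ_minimal hs) (occ_causal hs).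

Definition Pos (A : arena) (sigma : strategy A) : (config A -> Prop) -> Prop :=
  fun X => exists s (hs : plays sigma s) (wo : well_opened s),
    X = position (deseq (strategy_play hs) wo).

(* Main.v *)
(** Let [v] be a P-view of [sigma1] of length [2n], at least as long as every
    P-view of [sigma2]. By innocence, [sigma1] contains a play [s] that is a
    tree of copies of [v] in which Opponent duplicates each of his moves: every copy
    of the [d]-th Player move of [v] is pointed to by exactly [n - d] moves, so
    that the branching strictly decreases with the depth. Equality of positions
    gives a play [t] of [sigma2] with the same moves and pointers. Each Opponent
    move of [t] is again answered once, so [t] is a tree with the same nodes and
    branching numbers as [s], but possibly arranged differently, and its height
    is at most [n] because its branches are P-views of [sigma2]. Only the
    arrangement with decreasing branching fits that many nodes in height [n],
    so every move has the same depth in [s] and in [t]; hence the full branches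
    of [t] are copies of [v]. *)

Require Import Defs.
From mathcomp Require Import all_boot all_order.
From mathcomp Require Import boolp classical_sets.
From mathcomp Require Import zify.

Set Implicit Arguments.
Unset Strict Implicit.
Unset Printing Implicit Defensive.

Import Order.TTheory.

(** * Greedy level structures *)

(** Exchange argument: the elements of [X :\: Y] weigh at least [k.+1] each, those of [Y :\: X] at
    most [k], and the latter are no more numerous. Equality of the sums therefore leaves [X :\: Y]
    empty. *)
Lemma leq_sum_top (T : finType) (X Y : {set T}) (w : T -> nat) k :
  (forall i, i \in X -> k < w i) -> (forall i, i \notin X -> w i <= k) ->
  #|Y| <= #|X| ->
  \sum_(i in Y) w i <= \sum_(i in X) w i ?= iff (Y == X).
Proof.
move=> wX wY le_YX.
have splitX := cardsID Y X; have splitY := cardsID X Y.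
have cX : k.+1 * #|X :\: Y| <= \sum_(i in X :\: Y) w i.
  rewrite mulnC -sum_nat_const; apply: leq_sum => i.
  by rewrite inE => /andP[_ /wX].
have cY : \sum_(i in Y :\: X) w i <= k * #|Y :\: X|.
  rewrite mulnC -sum_nat_const; apply: leq_sum => i.
  by rewrite inE => /andP[/wY].
have le_D : #|Y :\: X| <= #|X :\: Y| by rewrite finset.setIC in splitY; lia.
have le_kD : k * #|Y :\: X| <= k * #|X :\: Y| by rewrite leq_mul2l le_D orbT.
rewrite (big_setID X) [X in _ <= X ?= iff _](big_setID Y) /=.
rewrite [Y :&: X]finset.setIC.
split; first by rewrite leq_add2l; lia.
apply/eqP/eqP => [e|->]; last by rewrite finset.setIid.
have D0 : #|X :\: Y| = 0 by lia.
apply/esym/eqP; rewrite eqEcard le_YX andbT -finset.setD_eq0 -cards_eq0.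
by rewrite D0.
Qed.

(* [X d] and [Y d] are the nodes in the first [d] levels of two trees that have
   the same nodes and the same number [w i] of children at each node [i]: the
   greedy arrangement [X] fills every level at least as fast as [Y]. *)
Lemma levels_eq (T : finType) (w : T -> nat) (X Y : nat -> {set T}) n :
  X 0 = finset.set0 -> Y 0 = finset.set0 ->
  (forall d, #|X d.+1| = (\sum_(i in X d) w i).+1) ->
  (forall d, #|Y d.+1| = (\sum_(i in Y d) w i).+1) ->
  (forall d i, d < n -> (i \in X d) = (n - d <= w i)) ->
  #|X n| = #|Y n| ->
  forall d, d < n -> X d = Y d.
Proof.
move=> X0 Y0 cX cY wX cn.
(* [X d] is the set where [w] is at least [n - d], so the threshold is [n - d - 1]. *)
have top d : d < n -> #|Y d| <= #|X d| ->
    \sum_(i in Y d) w i <= \sum_(i in X d) w i ?= iff (Y d == X d).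
  move=> lt_d; apply: (@leq_sum_top _ _ _ _ (n - d).-1) => i.
    by rewrite wX // => h; lia.
  by rewrite wX // -ltnNge => h; lia.
have le d : d <= n -> #|Y d| <= #|X d|.
  elim: d => [|d IH] le_d; first by rewrite X0 Y0.
  by rewrite cX cY ltnS; apply: top => //; apply: IH; exact: ltnW.
(* Downward induction from level [n]: equal cardinals at level [d.+1] mean equal sums at level [d],
   and the equality case of [top] then gives [X d = Y d]. *)
suff eqc d : d <= n -> #|X (n - d)| = #|Y (n - d)|.
  move=> d lt_d; have := eqc (n - d.+1).
  rewrite subKn // cX cY => /(_ (leq_subr _ _))[e].
  by have [_ h] := top d lt_d (le _ (ltnW lt_d)); apply/esym/eqP; rewrite -h e.
elim: d => [|d IH] lt_d; first by rewrite subn0.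
have e : n - d = (n - d.+1).+1 by lia.
have := IH (ltnW lt_d); rewrite e cX cY => -[es].
have lt_e : n - d.+1 < n by lia.
have := top _ lt_e (le _ (ltnW lt_e)); case=> _; rewrite es eqxx.
by move/esym/eqP->.
Qed.

(** * Views and depths *)

Section Views.
Context {A : arena}.
Implicit Types (s t v : pstring A) (i j k d : nat) (o : seq nat).

Lemma onth_lt s i m : onth s i = Some m -> i < size s.
Proof. by rewrite -onthTE => ->. Qed.

Lemma onth_some s i : i < size s -> exists m, onth s i = Some m.
Proof. by rewrite -onthTE; case: onth => // m _; exists m. Qed.

Lemma view_size s k o : view s k o -> k <= size s.
Proof.
by case=> // {}k => [m /onth_lt|n m p {}o _ _ /onth_lt|n m p {}o /onth_lt].
Qed.

Lemma view_agree s t k o :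
  (forall i, i < k -> onth s i = onth t i) -> view s k o -> view t k o.
Proof.
move=> + vo; elim: vo => {k o}.
- by move=> _; exact: view_nil.
- by move=> k m sk minm st; apply: view_init minm; rewrite -st.
- move=> k n m p o sk nn sk1 pm _ IH po st.
  apply: (@view_player _ t k n m p); rewrite -?st //.
  by apply: IH => i ltik; apply: st; exact: leqW.
- move=> k n m p o sk nm pk sp pn _ IH st.
  apply: (@view_opponent _ t k n m p); rewrite -?st //; first exact: leqW.
  by apply: IH => i ltip; apply: st; apply: leq_trans ltip _; exact: leqW.
Qed.

Lemma view_last s k o : view s k.+1 o -> exists o', o = rcons o' k.
Proof. by move=> vo; inversion vo; subst; [exists [::]|eexists|eexists]. Qed.

(** Each recursive constructor appends one index to a shorter view, so cutting [o] short undoes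
    constructors and leaves a view. *)
Lemma view_nth s k o d : view s k o -> d < size o ->
  nth 0 o d < k /\ view s (nth 0 o d).+1 (take d.+1 o).
Proof.
have snoc k' k1 o1 : view s k'.+1 (rcons o1 k') -> k1 <= k'.+1 ->
    (forall d, d < size o1 -> nth 0 o1 d < k1 /\
       view s (nth 0 o1 d).+1 (take d.+1 o1)) ->
    forall d, d < size (rcons o1 k') -> nth 0 (rcons o1 k') d < k'.+1 /\
       view s (nth 0 (rcons o1 k') d).+1 (take d.+1 (rcons o1 k')).
  move=> vo le_k1 IH e; rewrite size_rcons ltnS leq_eqVlt => /predU1P[->|lt_e].
    by rewrite nth_rcons ltnn eqxx take_oversize ?size_rcons.
  have [lt_k1 ?] := IH _ lt_e.
  rewrite nth_rcons lt_e -cats1 takel_cat //; split=> //.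
  exact: leq_trans le_k1.
move=> vo; have := vo; elim: vo d => {k o} //=.
- by move=> k m sk minm [|[]] // vw _.
- move=> k n m p o sk nn sk1 pm vo IH po d vw.
  by apply: (snoc _ k.+1) => // e; exact: IH.
- move=> k n m p o sk nm pk sp pn vo IH d vw.
  by apply: (snoc _ p.+1) => //; [exact: leqW|move=> e; exact: IH].
Qed.

Section Play.
Variable s : pstring A.
Hypothesis play_s : is_play s.

Lemma play_ptr i a p : onth s i = Some (a, Some p) ->
  p < i /\ exists m, onth s p = Some m /\ covers m.1 a.
Proof. by case: play_s => + _ _; apply. Qed.

Lemma play_init i a : onth s i = Some (a, None) -> minimal a.
Proof. by case: play_s => _ + _; apply. Qed.

Lemma play_minimal i m : onth s i = Some m -> minimal m.1 <-> m.2 = None.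
Proof.
case: m => a [p|] /=; last by move/play_init.
case/play_ptr=> _ [n [_ [lt_na _]]]; split=> // mina.
by have := mina _ (ltW lt_na) => e; rewrite e ltxx in lt_na.
Qed.

Lemma play_pos i m : onth s i = Some m -> pos m.1 = odd i.
Proof.
elim: i m => [|i IH] m si.
  apply/negbTE/arena_negative/(play_minimal si).
  by case: m si => a [p|] // /play_ptr[].
have lt_i := onth_lt si; have [n si'] := onth_some (ltnW lt_i).
case: play_s => _ _ /(sortedP m)/(_ i lt_i).
rewrite (onth_nth _ _ _ _ si) (onth_nth _ _ _ _ si') (IH _ si') /=.
by case: odd; case: pos.
Qed.

Lemma play_ptr_odd i a p : onth s i = Some (a, Some p) -> odd p = ~~ odd i.
Proof.
move=> si; have [_ [n [sp /arena_alternating]]] := play_ptr si.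
by rewrite (play_pos sp) (play_pos si); do 2!case: odd.
Qed.

(** Inversion of [view] with polarity read as parity: a Player move extends the view of the prefix
    before it, an Opponent move the view that ends at its target. *)
Lemma viewS k a q o : onth s k = Some (a, q) -> view s k.+1 o ->
  if q isn't Some p then o = [:: k] else
  exists2 o', view s (if odd k then k else p.+1) o' &
    p \in o' /\ o = rcons o' k.
Proof.
move=> sk vo; inversion vo as [|k' m skm minm
  |k' n m p o' skn nn skm pm vo' po'|k' n m p o' skm nm pk spn pn vo']; subst.
- by move/(play_minimal skm): minm; move: skm; rewrite sk => -[<-] /= ->.
- move: skm; rewrite sk => -[? ?]; subst m q; exists o' => //.
  by have /= <- := play_pos sk; rewrite pm.
- move: skm; rewrite sk => -[? ?]; subst m q.
  have /= <- := play_pos sk; rewrite (negbTE nm); exists o' => //.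
  by have [o1 ->] := view_last vo'; rewrite mem_rcons mem_head.
Qed.

Lemma view_uniq k o o' : view s k o -> view s k o' -> o = o'.
Proof.
have [n] := ubnP k; elim: n k o o' => // n IH [|k] o o' lt_kn vo vo'.
  by inversion vo; inversion vo'.
have [[a q] sk] := onth_some (view_size vo).
have := viewS sk vo; have := viewS sk vo'.
case: q sk => [p|] sk; last by move=> -> ->.
case=> o1 vo1 [_ ->] [o2 vo2 [_ ->]].
suff -> : o1 = o2 by [].
by apply: IH vo1 vo2; case: ifP => _ //; have [] := play_ptr sk; lia.
Qed.

Lemma view_odd k o : view s k o -> odd (size o) = odd k.
Proof.
have [n] := ubnP k; elim: n k o => // n IH [|k] o lt_kn vo.
  by inversion vo.
have [[a q] sk] := onth_some (view_size vo).
have := viewS sk vo; have := play_pos sk; case: q sk => [p|] sk /=.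
  have [lt_pk _] := play_ptr sk; have odd_p := play_ptr_odd sk.
  move=> _ [o' vo' [_ ->]]; rewrite size_rcons /= (IH _ _ _ vo').
    by case: ifP odd_p => /= ok; rewrite ?ok // => ->.
  by case: ifP => _; lia.
by move=> odd_k -> /=; rewrite -odd_k arena_negative //; exact: play_init sk.
Qed.

End Play.

(** Undefined views take the default [[::]], for which [depth] is [0]. *)
Definition viewf s k := xget [::] [set o | view s k o]%classic.

(* The 0-based position of the move [i] in its own P-view. *)
Definition depth s i := (size (viewf s i.+1)).-1.

(* Depths do not depend on the view in which they are computed, so [annot s i]
   is the move that [extract] produces from [i] in any view containing [i]. *)
Definition annot s i :=
  omap (fun m : A * option nat => (m.1, omap (depth s) m.2)) (onth s i).

Lemma viewfE s k o : is_play s -> view s k o -> viewf s k = o.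
Proof.
move=> ps vo; apply: xget_unique => // o' /= vo'.
by have -> := view_uniq ps vo' vo.
Qed.

Lemma depth_view s k o :
  is_play s -> view s k.+1 (rcons o k) -> depth s k = size o.
Proof. by move=> ps vo; rewrite /depth (viewfE ps vo) size_rcons. Qed.

Lemma depth_agree s t i :
  (forall j, j <= i -> onth s j = onth t j) -> depth s i = depth t i.
Proof.
move=> st; rewrite /depth /viewf; congr (size (xget _ _)).-1.
by apply/seteqP; split=> o /=; apply: view_agree => j /st.
Qed.

Lemma annot_agree s t i : is_play s ->
  (forall j, j <= i -> onth s j = onth t j) -> annot s i = annot t i.
Proof.
move=> ps st; rewrite /annot -st //; case si: (onth s i) => [[a [p|]]|] //=.
congr (Some (_, Some _)); apply: depth_agree => j le_jp; apply: st.
by have [] := play_ptr ps si; lia.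
Qed.

Section Extract.
Variables (s : pstring A) (k : nat) (o : seq nat).
Hypotheses (ps : is_play s) (vo : view s k o).

Lemma nth_depth d : d < size o -> depth s (nth 0 o d) = d.
Proof.
move=> lt_d; have [_ vd] := view_nth vo lt_d.
have [o' e] := view_last vd; rewrite e in vd; rewrite (depth_view ps vd).
by have := congr1 size e; rewrite size_rcons size_takel // => -[].
Qed.

Lemma index_depth p : p \in o -> index p o = depth s p.
Proof.
by move=> po; rewrite -{2}(nth_index 0 po) nth_depth // index_mem.
Qed.

(** The part of [o] up to [i] is the view at [i]; it contains the target by visibility for Player,
    and because the view of an Opponent move continues that of its target. *)
Lemma view_ptr i a p : i \in o -> onth s i = Some (a, Some p) -> p \in o.
Proof.
move=> io si; have lt_io : index i o < size o by rewrite index_mem.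
have [_] := view_nth vo lt_io.
rewrite nth_index // => vi; have [o' _ [po' e]] := viewS ps si vi.
by apply: (mem_take (n0 := (index i o).+1)); rewrite e mem_rcons inE po' orbT.
Qed.

Lemma map_extract : map Some (extract s o) = map (annot s) o.
Proof.
(* Pointers are renumbered with respect to the whole of [o], so the induction runs on a separate
   list [o'] while [o] stays fixed. *)
suff map_pmap o' : {subset o' <= o} ->
    map Some (pmap (fun i => omap (fun m => (m.1, omap (index^~ o) m.2))
      (onth s i)) o') = map (annot s) o' by exact: map_pmap.
elim: o' => //= i o' IH sub.
have io : i \in o by apply: sub; rewrite mem_head.
have lt_i : i < size s.
  have lt_io : index i o < size o by rewrite index_mem.
  have [+ _] := view_nth vo lt_io; rewrite nth_index // => lt_ik.
  exact: leq_trans lt_ik (view_size vo).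
have [[a q] si] := onth_some lt_i.
rewrite si /= IH; last by move=> j jo'; apply: sub; rewrite inE jo' orbT.
congr (_ :: _); rewrite /annot si /=; congr (Some (_, _)).
by case: q si => //= p si; rewrite index_depth // (view_ptr io si).
Qed.

Lemma size_extract : size (extract s o) = size o.
Proof. by have := congr1 size map_extract; rewrite !size_map. Qed.

Lemma onth_extract d : d < size o -> onth (extract s o) d = annot s (nth 0 o d).
Proof.
by move=> lt_d; rewrite onthE map_extract (nth_map 0).
Qed.

End Extract.

Definition viewable s := forall k, k <= size s -> exists o, view s k o.

Lemma onth_take k s i : onth (take k s) i = if i < k then onth s i else None.
Proof. by elim: s k i => [|m s IH] [|k] [|i] //=; [case: ifP|exact: IH]. Qed.

Lemma is_play_take k s : is_play s -> is_play (take k s).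
Proof.
case=> ptr init alt; split; last exact: take_sorted.
- move=> i a p; rewrite onth_take; case: ifP => // lt_ik /ptr[lt_pi sp].
  by rewrite onth_take (ltn_trans lt_pi lt_ik).
- by move=> i a; rewrite onth_take; case: ifP => // _ /init.
Qed.

Definition justified t (m : A * option nat) : Prop :=
  if m.2 is Some i then exists2 n, onth t i = Some n & covers n.1 m.1
  else minimal m.1.

Lemma is_play_rcons t m : is_play t ->
  pos m.1 = odd (size t) ->
  justified t m ->
  is_play (t ++ [:: m]).
Proof.
rewrite /justified => pt pm ptr; split.
- move=> i a p; rewrite onth_cat; case: ifP => lt_i.
    case/(play_ptr pt) => lt_pi [n [tp cov]]; split=> //; exists n.
    by rewrite onth_cat (onth_lt tp).
  case e: (i - size t) => [|[]] //= [em]; rewrite em /= in ptr.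
  case: ptr => n tp cov; have lt_p := onth_lt tp; split; first by lia.
  by exists n; rewrite onth_cat lt_p.
- move=> i a; rewrite onth_cat; case: ifP => lt_i; first exact: (play_init pt).
  by case: (i - size t) => [|[]] //= [em]; rewrite em in ptr.
- apply/(sortedP m) => i; rewrite size_cat addn1 ltnS => le_i.
  have [n ti] : exists n, onth t i = Some n by apply: onth_some.
  have ei : nth m (t ++ [:: m]) i = n.
    by rewrite nth_cat le_i (onth_nth _ _ _ _ ti).
  rewrite ei (play_pos pt ti) nth_cat; case: ltnP => [lt_i|ge_i].
    have [n' ti'] := onth_some lt_i.
    by rewrite (onth_nth _ _ _ _ ti') (play_pos pt ti') /=; case: odd.
  have -> : i.+1 - size t = 0 by lia.
  by rewrite /= pm (_ : size t = i.+1) /=; [case: odd|lia].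
Qed.

Lemma pview_uniq s v w : is_play s -> pview s v -> pview s w -> v = w.
Proof. by move=> ps [o vo ->] [o' vo' ->]; rewrite (view_uniq ps vo vo'). Qed.

Lemma depth_root s i a : is_play s -> viewable s ->
  onth s i = Some (a, None) -> depth s i = 0.
Proof.
move=> ps vs si; have [o vo] := vs i.+1 (onth_lt si).
by rewrite /depth (viewfE ps vo) (viewS ps si vo).
Qed.

Lemma depthS s i a p : is_play s -> viewable s ->
  onth s i = Some (a, Some p) ->
  depth s i = (depth s (if odd i then i.-1 else p)).+1.
Proof.
move=> ps vs si; have [o vo] := vs i.+1 (onth_lt si).
have [o' vo' [_ e]] := viewS ps si vo; rewrite e in vo.
set k := if odd i then i else p.+1 in vo'; rewrite (depth_view ps vo).
have -> : (if odd i then i.-1 else p) = k.-1 by rewrite /k; case: ifP.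
have : 0 < k by rewrite /k; case: ifP => //; case: (i).
case: k vo' => // k vo' _; have [o'' e''] := view_last vo'.
by rewrite e'' in vo' *; rewrite (depth_view ps vo') size_rcons.
Qed.

Lemma depth_odd s i : is_play s -> viewable s -> i < size s ->
  odd (depth s i) = odd i.
Proof.
move=> ps vs lt_i; have [o vo] := vs _ lt_i.
have := view_odd ps vo; have [o' e] := view_last vo; rewrite e in vo *.
rewrite (depth_view ps vo) size_rcons /=.
by do 2!case: odd.
Qed.

(** [annot] at an index depends only on the moves up to that index, so truncating the play leaves
    these entries unchanged. *)
Lemma pview_take s k o d : is_play s -> view s k o -> d < size o ->
  pview (take (nth 0 o d).+1 s) (take d.+1 (extract s o)).
Proof.
move=> ps vo lt_d; have [_ vd] := view_nth vo lt_d.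
set i := nth 0 o d in vd *.
have le_i : i.+1 <= size s := view_size vd.
have agree j : j < i.+1 -> onth s j = onth (take i.+1 s) j.
  by move=> lt_j; rewrite onth_take lt_j.
have vt : view (take i.+1 s) i.+1 (take d.+1 o) by apply: view_agree vd.
have pt := is_play_take i.+1 ps.
exists (take d.+1 o); first by rewrite size_takel.
apply: eq_from_onth => e; rewrite onth_take.
have sz : size (take d.+1 o) = d.+1 by rewrite size_takel.
case: ifP => lt_e; last first.
  by rewrite onth_default // (size_extract pt vt) sz leqNgt lt_e.
rewrite (onth_extract pt vt) ?sz //.
rewrite (onth_extract ps vo); last exact: leq_trans lt_d.
rewrite nth_take //; apply: annot_agree => // j le_j; apply: agree.
apply: leq_ltn_trans le_j _.
by have [] := view_nth vd (_ : e < _); rewrite ?sz // nth_take.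
Qed.

(* Every P-view of [s] is a prefix of [v]. *)
Definition follows v s :=
  forall i, i < size s -> onth v (depth s i) = annot s i.

Lemma follows_extract v t k o : is_play t -> follows v t -> view t k o ->
  extract t o = take (size o) v.
Proof.
move=> pt fol vo; apply: eq_from_onth => e; rewrite onth_take.
case: ifP => lt_e; last first.
  by rewrite onth_default // (size_extract pt vo) leqNgt lt_e.
have [lt_k _] := view_nth vo lt_e.
rewrite (onth_extract pt vo lt_e) -fol ?(nth_depth pt vo lt_e) //.
exact: leq_trans lt_k (view_size vo).
Qed.

Lemma onth_catl t u j : j < size t -> onth (t ++ u) j = onth t j.
Proof. by rewrite onth_cat => ->. Qed.

Lemma depth_cat t u j : j < size t -> depth (t ++ u) j = depth t j.
Proof.
by move=> lt_j; apply: depth_agree => i le_i; rewrite onth_catl //; lia.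
Qed.

Lemma annot_cat t u j : is_play t -> j < size t -> annot (t ++ u) j = annot t j.
Proof.
move=> pt lt_j; symmetry; apply: annot_agree => // i le_i.
by rewrite onth_catl //; lia.
Qed.

Lemma follows_rcons v t m : is_play t -> follows v t ->
  onth v (depth (t ++ [:: m]) (size t)) = annot (t ++ [:: m]) (size t) ->
  follows v (t ++ [:: m]).
Proof.
move=> pt fol new i; rewrite size_cat addn1 ltnS leq_eqVlt.
case/predU1P=> [->//|lt_i].
by rewrite depth_cat // annot_cat // fol.
Qed.

(** * Growing a play of an innocent strategy along a view *)

Lemma innocent_view sigma s : innocent sigma -> plays sigma s -> viewable s.
Proof.
move=> [views _] ss k le_k; have [v [o vo _]] := views s k ss.
exists o; rewrite size_takel // in vo; apply: view_agree vo => i lt_i.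
by rewrite onth_take lt_i.
Qed.

(** For even [d] the move [d.+1] of [v] is Player's, and a Player move extends the view ending just
    before it. Hence the moves [d] and [d.+1] of [v] are adjacent in the play and form a pair to
    which innocence applies. *)
Lemma pviews_take sigma v d : pviews sigma v -> ~~ odd d -> d.+1 < size v ->
  exists s a b, [/\ plays sigma (s ++ [:: a; b]),
    pview (s ++ [:: a]) (take d.+1 v) & pview (s ++ [:: a; b]) (take d.+2 v)].
Proof.
case=> s ss [o vo ->]; have ps := strategy_play ss.
rewrite (size_extract ps vo) => even_d lt_d.
have [_ vi] := view_nth vo lt_d; set i := nth 0 o d.+1 in vi.
have odd_i : odd i.
  by have := view_odd ps vi; rewrite size_takel //=; rewrite even_d; case: odd.
have lt_i : i < size s := view_size vi.
have [[b q] si] := onth_some lt_i.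
have ei : i = i.-1.+1 by case: (i) odd_i.
have sz : size (take d.+2 o) = d.+2 by rewrite size_takel.
have [o' vo' eo'] : exists2 o', view s i o' & take d.+2 o = rcons o' i.
  have := viewS ps si vi; case: (q) => [p|e]; last by rewrite e in sz.
  by rewrite odd_i => -[o' ? [_ ?]]; exists o'.
have ed : nth 0 o d = i.-1.
  rewrite ei in vo'; have [o'' e''] := view_last vo'.
  rewrite -(@nth_take d.+2) // eo' e'' nth_rcons nth_rcons size_rcons.
  have : size o'' = d by move: sz; rewrite eo' e'' !size_rcons => -[].
  by move=> ->; rewrite leqnn ltnn eqxx.
have [a si'] : exists a, onth s i.-1 = Some a by apply: onth_some; lia.
have take_i : take i s = take i.-1 s ++ [:: a].
  by rewrite {1}ei (take_nth a) ?(onth_nth _ _ _ _ si') ?cats1 //; lia.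
have take_iS : take i.+1 s = take i.-1 s ++ [:: a; (b, q)].
  by rewrite (take_nth a) // (onth_nth _ _ _ _ si) take_i -cats1 -catA.
have := pview_take ps vo (ltnW lt_d); have := pview_take ps vo lt_d.
rewrite ed -ei -/i take_i take_iS => v2 v1.
exists (take i.-1 s), a, (b, q); split=> //; rewrite -take_iS.
apply: (@strategy_prefix _ _ _ (drop i.+1 s)).
  by rewrite size_takel //= odd_i.
by rewrite cat_take_drop.
Qed.

Lemma viewable_catl s t : viewable (s ++ t) -> viewable s.
Proof.
move=> vst k le_k; have [|o vo] := vst k; first by rewrite size_cat; lia.
by exists o; apply: view_agree vo => i lt_i; rewrite onth_catl //; lia.
Qed.

Lemma is_play_catl s t : is_play (s ++ t) -> is_play s.
Proof. by move/(is_play_take (size s)); rewrite take_size_cat. Qed.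

Lemma pview_last u m w : is_play (u ++ [:: m]) -> pview (u ++ [:: m]) w ->
  size w = (depth (u ++ [:: m]) (size u)).+1 /\
  onth w (depth (u ++ [:: m]) (size u)) = annot (u ++ [:: m]) (size u).
Proof.
move=> pu [o]; rewrite size_cat addn1 => vo ->.
rewrite (size_extract pu vo); have [o' e] := view_last vo; rewrite e in vo *.
rewrite (depth_view pu vo) size_rcons (onth_extract pu vo) ?size_rcons //.
by rewrite nth_rcons ltnn eqxx.
Qed.

(* Opponent plays in [t] a further copy of the move [d] of [v]; by innocence,
   [sigma] answers with the move [d.+1] of [v]. *)
Lemma grow sigma v t pa : innocent sigma -> pviews sigma v ->
  plays sigma t -> follows v t ->
  let d := if pa is Some i then (depth t i).+1 else 0 in
  (if pa is Some i then odd i && (i < size t) else true) -> d.+1 < size v ->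
  exists a b, plays sigma (t ++ [:: (a, pa); b]) /\
    follows v (t ++ [:: (a, pa); b]).
Proof.
move=> inn sv st fol d hpa lt_d.
have pt := strategy_play st; have vt := innocent_view inn st.
have even_t := strategy_even st.
have even_d : ~~ odd d.
  rewrite /d; case: (pa) hpa => //= i /andP[odd_i lt_i].
  by rewrite depth_odd // odd_i.
have [s [[a qa] [b [ss v1 v2]]]] := pviews_take sv even_d lt_d.
have even_s : ~~ odd (size s).
  by have := strategy_even ss; rewrite size_cat addn2 /= negbK.
have cat2 (w : pstring A) x y : w ++ [:: x; y] = (w ++ [:: x]) ++ [:: y].
  by rewrite -catA.
have ps2 := strategy_play ss; have vs2 := innocent_view inn ss.
have [ps1 vs1] : is_play (s ++ [:: (a, qa)]) /\ viewable (s ++ [:: (a, qa)]).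
  rewrite cat2 in ps2 vs2.
  by split; [exact: is_play_catl ps2|exact: viewable_catl vs2].
have su : onth (s ++ [:: (a, qa)]) (size s) = Some (a, qa).
  by rewrite onth_cat ltnn subnn.
have [] := pview_last ps1 v1; rewrite size_takel; last exact: ltnW.
case=> ed; rewrite -ed onth_take ltnS leqnn => vd.
(* A non-initial Opponent move points to the preceding move of the view, and that move has the depth
   of the chosen target in [t]. *)
have vde : onth v d = Some (a, omap (depth t) pa).
  rewrite vd /annot su /=; congr (Some (_, _)).
  case: (qa) ed su ps1 vs1 => [p|] ed su ps1 vs1.
    have := depthS ps1 vs1 su; rewrite -ed (negbTE even_s) /d.
    by case: (pa) => //= i -[->].
  by have := depth_root ps1 vs1 su; rewrite -ed /d; case: (pa).
(* The targets in [s] and in [t] are copies of the same move of [v], so the covering relation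
   carries over. *)
have minA : justified t (a, pa).
  rewrite /justified /=.
  case: (qa) ed su ps1 vs1 v1 => [p|] ed su ps1 vs1 [o vo eo]; last first.
    have := depth_root ps1 vs1 su; rewrite -ed /d; case: (pa) => // _.
    exact: play_init su.
  have := depthS ps1 vs1 su; rewrite -ed (negbTE even_s) /d.
  case: (pa) hpa => //= i /andP[_ lt_i] -[edi].
  have [_ [m [sp cov]]] := play_ptr ps1 su.
  have po : p \in o.
    apply: (view_ptr ps1 vo _ su).
    rewrite size_cat addn1 in vo; have [o' ->] := view_last vo.
    by rewrite mem_rcons mem_head.
  have lt_p : index p o < size o by rewrite index_mem.
  have := onth_extract ps1 vo lt_p.
  rewrite nth_index // (index_depth ps1 vo po) -eo onth_take -edi.
  have [n ti] := onth_some lt_i.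
  rewrite fol // /annot sp ti /=; case: ifP => // _ [en _].
  by exists n; rewrite ?en.
have neg_a : pos a = odd (size t).
  have /= -> := play_pos ps1 su.
  by rewrite (negbTE even_s) (negbTE even_t).
have pt1 : is_play (t ++ [:: (a, pa)]) by exact: is_play_rcons.
have tu : onth (t ++ [:: (a, pa)]) (size t) = Some (a, pa).
  by rewrite onth_cat ltnn subnn.
have [o vo sz] : exists2 o,
    view (t ++ [:: (a, pa)]) (size t).+1 (rcons o (size t)) & size o = d.
  rewrite /d; case: (pa) hpa minA tu pt1 => [i|_ mina tu pt1]; last first.
    by exists [::] => //; exact: (view_init tu).
  move=> /andP[odd_i lt_i] [n ti cov] tu pt1.
  have [o vo] := vt i.+1 lt_i; have [o' e] := view_last vo.
  exists o; last by rewrite e in vo *; rewrite (depth_view pt vo) size_rcons.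
  apply: (view_opponent (n := n) tu) => //.
  - by rewrite neg_a.
  - by rewrite onth_catl.
  - by rewrite (play_pos pt ti).
  - apply: view_agree vo => j lt_j; rewrite onth_catl //.
    exact: leq_trans lt_i.
have edt : depth (t ++ [:: (a, pa)]) (size t) = d.
  by rewrite (depth_view pt1 vo).
have fol1 : follows v (t ++ [:: (a, pa)]).
  apply: follows_rcons => //; rewrite edt vde /annot tu /=.
  by case: (pa) hpa => //= i /andP[_ lt_i]; rewrite depth_cat.
(* Both views are [take d.+1 v]: in [s] by choice, in [t] because the extended play still follows
   [v]. *)
have [] := proj2 inn s t a b.1 qa b.2 pa _ st pt1 _.
- by rewrite -surjective_pairing.
- exists (take d.+1 v); split=> //.
  exists (rcons o (size t)); first by rewrite size_cat addn1.
  by rewrite (follows_extract pt1 fol1 vo) size_rcons sz.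
rewrite -surjective_pairing => pb [st2 [w [w1 w2]]].
exists a, (b.1, pb); split=> //.
have ew := pview_uniq ps2 v2 w1; rewrite -ew in w2.
have := strategy_play st2; rewrite cat2 in w2 *; move=> pt2.
have [] := pview_last pt2 w2; rewrite size_takel // => -[ed2].
by rewrite -ed2 onth_take ltnS leqnn ed2; exact: follows_rcons.
Qed.

(** * The saturated tree of copies of a view *)

Definition rooted s := forall i a, onth s i = Some (a, None) -> i = 0.

Lemma onth_tnth s (j : 'I_(size s)) : onth s j = Some (tnth (in_tuple s) j).
Proof.
have [m sj] := onth_some (ltn_ord j).
by rewrite sj (tnth_nth m) /= (onth_nth _ _ _ _ sj).
Qed.

(** For odd [i] only Opponent moves of a play point to [i]: this is the branching number of a Player
    move. *)
Definition pointers s i := count (fun m : A * option nat => m.2 == Some i) s.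

Lemma pointers_sum s i :
  pointers s i = \sum_(j < size s) ((tnth (in_tuple s) j).2 == Some i).
Proof.
rewrite /pointers -sum1_count big_mkcond big_tnth.
by apply: eq_bigr => j _; case: eqP.
Qed.

Lemma pointers_has s i :
  0 < pointers s i -> exists j a, onth s j = Some (a, Some i).
Proof.
move=> gt0; apply: contrapT => h; move: gt0.
rewrite pointers_sum big1 // => j _; case: eqP => // e; case: h.
by exists j, (tnth (in_tuple s) j).1; rewrite onth_tnth -e -surjective_pairing.
Qed.

Lemma play_root s :
  is_play s -> 0 < size s -> exists a, onth s 0 = Some (a, None).
Proof.
move=> ps /onth_some[[a [p|]] s0]; last by exists a.
by have [] := play_ptr ps s0.
Qed.

(** Player moves have odd depth, so these are the first [d] levels of the tree whose nodes are the
    Player moves, each merged with the Opponent move before it. *)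
Definition low s d := [set i : 'I_(size s) | odd i && (depth s i < d.*2)].

Section Counting.
Variable s : pstring A.
Hypotheses (ps : is_play s) (vs : viewable s) (even_s : ~~ odd (size s)).

Lemma depth_succ i : ~~ odd i -> i.+1 < size s -> depth s i.+1 = (depth s i).+1.
Proof.
move=> even_i lt_i; have [[a [p|]] si] := onth_some lt_i.
  by rewrite (depthS ps vs si) /= even_i.
have /(arena_negative (a:=a)) := play_init ps si.
by have /= -> := play_pos ps si; rewrite even_i.
Qed.

(* Each Opponent move is paired with the Player move that follows it. *)
Lemma card_lowS d : #|low s d.+1| =
  #|[set j : 'I_(size s) | ~~ odd j && (depth s j < d.*2.+1)]|.
Proof.
(* The default of [insubd] is never met: an even index is not the last one of a string of even
   length. *)
pose g (j : 'I_(size s)) := insubd j j.+1.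
have gE (j : 'I_(size s)) : ~~ odd j -> g j = j.+1 :> nat.
  move=> even_j; rewrite val_insubd; case: ltnP => // le_s.
  have e : size s = j.+1 by apply/eqP; rewrite eqn_leq le_s ltn_ord.
  by have := congr1 odd e; rewrite /= even_j (negbTE even_s).
rewrite -[RHS](@card_in_imset _ _ g); last first.
  move=> /= j j'; rewrite !inE => /andP[ej _] /andP[ej' _] e.
  by apply/val_inj/succn_inj; rewrite -(gE _ ej) -(gE _ ej') e.
apply: eq_card => i; rewrite inE; apply/andP/imsetP.
  case=> odd_i lt_i; have ei : i.-1.+1 = i :> nat by case: (i : nat) odd_i.
  have lt_is : i.-1 < size s by rewrite ei ltnW.
  have even_i : ~~ odd i.-1 by rewrite -ei in odd_i.
  exists (Ordinal lt_is); last by apply/ord_inj; rewrite gE /= ?ei.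
  by rewrite inE /= even_i; rewrite -ei depth_succ // ?ei in lt_i.
case=> j; rewrite inE => /andP[even_j lt_j] ->; rewrite gE //=; split=> //.
by rewrite depth_succ // -gE.
Qed.

Hypotheses (root_s : rooted s) (s_gt0 : 0 < size s).

(** By [card_lowS], Opponent moves are counted instead: apart from the root, each points to exactly
    one Player move, one step less deep, and grouping by target yields the sum. *)
Lemma card_low d :
  #|low s d.+1| = (\sum_(i in low s d) pointers s i).+1.
Proof.
have [a s0] := play_root ps s_gt0.
rewrite card_lowS (cardsD1 (Ordinal s_gt0)) !inE /= (depth_root ps vs s0) add1n.
congr _.+1; under eq_bigr => i _ do rewrite pointers_sum.
rewrite exchange_big /= -sum1_card big_mkcond; apply: eq_bigr => j _.
rewrite !inE; have := onth_tnth j; case: (tnth _ j) => b [p|] sj /=; last first.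
  by rewrite -val_eqE /= (root_s sj) eqxx /= big1.
have lt_p : p < size s by have [_ [m [/onth_lt]]] := play_ptr ps sj.
have odd_p := play_ptr_odd ps sj.
have nz : j != Ordinal s_gt0.
  by rewrite -val_eqE /=; case: (play_ptr ps sj) => + _; case: (j : nat).
rewrite nz /=; case: ifP => [/andP[even_j lt_j]|h].
  rewrite (bigD1 (Ordinal lt_p)) /=.
    rewrite eqxx big1 // => i /andP[_]; rewrite -val_eqE /= => ne.
    by case: eqP => // -[e]; rewrite e eqxx in ne.
  rewrite inE /= odd_p even_j.
  by rewrite (depthS ps vs sj) (negbTE even_j) in lt_j.
rewrite big1 // => i; rewrite inE => /andP[odd_i lt_i]; case: eqP => // -[e].
move: h; rewrite (depthS ps vs sj) -[odd j]negbK -odd_p e odd_i /=.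
by rewrite ltnS lt_i.
Qed.

Lemma size_low d : (forall i, i < size s -> depth s i < d.*2.+1) ->
  size s = #|low s d.+1|.*2.
Proof.
move=> bound; rewrite -[LHS]card_ord -addnn {1}card_lowS.
rewrite -(cardsC [set j : 'I_(size s) | ~~ odd j]); congr (_ + _).
  by apply: eq_card => j; rewrite !inE bound ?andbT.
apply: eq_card => j; rewrite !inE negbK; case: (odd j) => //=.
by rewrite doubleS ltnW // ltnS bound.
Qed.

End Counting.

(* The [d]-th Player move of [v] is at depth [2d - 1], so that each of its copies
   is pointed to by [n - d] moves. *)
Lemma saturated_play sigma v n : innocent sigma -> pviews sigma v ->
  size v = n.*2 -> 0 < n ->
  exists s, [/\ plays sigma s, rooted s, 0 < size s, follows v s &
    forall i, odd i -> i < size s -> pointers s i = n - (depth s i).+1./2].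
Proof.
move=> inn sv sz n_gt0.
(* Equality is relaxed to an upper bound on the branching; where it is strict the play can be grown,
   and [bound] stops the growth. *)
pose good s := [/\ plays sigma s, rooted s, 0 < size s, follows v s &
    forall i, odd i -> i < size s -> pointers s i <= n - (depth s i).+1./2].
(* Only the branching at the target of [a] changes: Player's [b] points to an even index, and
   nothing points to [b] yet. *)
have good_cat t pa a b : plays sigma t -> rooted t ->
   (forall i, odd i -> i < size t ->
     pointers t i + (pa == Some i) <= n - (depth t i).+1./2) ->
   (pa = None -> t = [::]) -> 
   plays sigma (t ++ [:: (a, pa); b]) -> follows v (t ++ [:: (a, pa); b]) ->
   good (t ++ [:: (a, pa); b]).
  move=> st rt art pat st2 fol2.
  have even_t := strategy_even st.
  have pt2 := strategy_play st2.
  have pt := strategy_play st.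
  have tb : onth (t ++ [:: (a, pa); b]) (size t).+1 = Some b.
    by rewrite onth_cat ltnNge leqnSn /= subSnn.
  have ta : onth (t ++ [:: (a, pa); b]) (size t) = Some (a, pa).
    by rewrite onth_cat ltnn subnn.
  split=> //.
  - move=> i c; rewrite onth_cat; case: ltnP => [_|ge_i]; first exact: rt.
    case e: (i - size t) => [|[|[]]] //= [] => [_ /pat et|eb].
      by move: e; rewrite et /= subn0.
    have := play_pos pt2 tb; rewrite eb /= even_t => pc.
    have /arena_negative := play_init pt2 (etrans tb (congr1 Some eb)).
    by rewrite pc.
  - by rewrite size_cat addn2.
  - move=> i odd_i; rewrite size_cat addn2 => lt_i.
    have nb : (b.2 == Some i) = false.
      apply/eqP => eb.
      have eb' : b = (b.1, Some i) by rewrite -eb -surjective_pairing.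
      have := play_ptr_odd pt2 (etrans tb (congr1 Some eb')).
      by rewrite /= odd_i even_t.
    rewrite /pointers count_cat /= nb !addn0 -/(pointers t i).
    have [lt_it|ge_i] := ltnP i (size t).
      by rewrite depth_cat //; exact: art.
    have -> : pointers t i = 0.
      apply/eqP; rewrite -leqn0 leqNgt; apply/negP => /pointers_has[j [c tj]].
      by have := onth_lt tj; have [] := play_ptr pt tj; lia.
    case: eqP => // ei.
    have [] := play_ptr pt2 (etrans ta (congr1 (fun q => Some (a, q)) ei)).
    by rewrite ltnNge ge_i.
(* With at most [n] children per node, [low s d] has at most [n.+1 ^ d] elements; at [d = n.+1] it
   contains all Player moves. *)
have bound s : good s -> size s <= (n.+1 ^ n.+1).*2.
  case=> ss rs s_gt0 fol ar; have ps := strategy_play ss.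
  have vs := innocent_view inn ss; have even_s := strategy_even ss.
  rewrite (@size_low s ps vs even_s n).
    rewrite leq_double; elim: {1 3}n.+1 => [|d IH].
      by rewrite (eq_card0 (A := low s 0)) // => i; rewrite inE andbF.
    rewrite card_low // expnS mulSn; apply: (@leq_add 1); rewrite ?expn_gt0 //.
    apply: leq_trans (leq_mul (leqnn n) IH); rewrite mulnC -sum_nat_const.
    apply: leq_sum => i; rewrite inE => /andP[odd_i _].
    by apply: leq_trans (ar _ odd_i _) _ => //; exact: leq_subr.
  move=> i lt_i; rewrite ltnS ltnW // -sz -onthTE fol //.
  by rewrite /annot; have [m ->] := onth_some lt_i.
have [s0 good0] : exists s, good s.
  have [s0 s0s] : exists2 s : pstring A, plays sigma s & s = [::].
    exists [::] => //; have [s ss] := strategy_nonempty sigma.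
    exact: (@strategy_prefix _ sigma [::] s).
  move=> es0; rewrite es0 in s0s.
  have fol0 : follows v [::] by [].
  have [|a [b [st fol]]] := @grow sigma v [::] None inn sv s0s fol0 isT.
    by rewrite sz; lia.
  by exists [:: (a, None); b]; apply: (good_cat [::]) => // i c; rewrite onth0n.
have [k] := ubnP ((n.+1 ^ n.+1).*2 - size s0).
elim: k s0 good0 => // k IH s gs lt_k.
have [[i [odd_i lt_i ari]]|sat] := pselect (exists i, [/\ odd i, i < size s &
    pointers s i < n - (depth s i).+1./2]); last first.
  have [ss rs s_gt0 fol ar] := gs; exists s; split=> // i odd_i lt_i.
  apply/eqP; rewrite eqn_leq ar //= leqNgt; apply/negP => h.
  by apply: sat; exists i.
have [ss rs s_gt0 fol ar] := gs.
have [|| a [b [st2 fol2]]] := @grow sigma v s (Some i) inn sv ss fol.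
- by rewrite odd_i.
(* The strict inequality makes [(depth s i).+1./2] less than [n], so [v] has two more moves below
   [i]. *)
- have := depth_odd (strategy_play ss) (innocent_view inn ss) lt_i.
  by rewrite sz odd_i; lia.
have gs2 : good (s ++ [:: (a, Some i); b]).
  apply: good_cat => // j odd_j lt_j; case: eqP => [[<-]|_].
    by rewrite addn1.
  by rewrite addn0 ar.
apply: (IH _ gs2).
have := bound _ gs; have := bound _ gs2.
rewrite size_cat addn2; lia.
Qed.

(** * Transfer along an isomorphism of positions *)

(** Isomorphisms respect immediate causality, which is here turned into pointers. An event strictly
    between would lie below the unique target of [j], which is [i] itself. *)
Lemma covers_points_to s (i j : occurrence s) : is_play s ->
  covers i j <-> points_to j i.
Proof.
move=> ps; split=> [/occ_covers //|ji]; split; first exact: points_to_lt ji.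
case=> k /andP[ik /occ_lt_pred[l jl kl]].
by have := lt_le_trans ik kl; rewrite (points_to_fun ji jl) ltxx.
Qed.

Section Transfer.
Variables (s t v : pstring A) (n : nat) (f : 'I_(size s) -> 'I_(size t)).
Hypotheses (ps : is_play s) (pt : is_play t).
Hypotheses (vs : viewable s) (vt : viewable t).
Hypotheses (even_s : ~~ odd (size s)) (even_t : ~~ odd (size t)).
Hypotheses (rs : rooted s) (rt : rooted t).
Hypotheses (s_gt0 : 0 < size s) (t_gt0 : 0 < size t).
Hypothesis bij_f : bijective f.
Hypothesis label_f : forall i : 'I_(size s),
  (tnth (in_tuple t) (f i)).1 = (tnth (in_tuple s) i).1.
Hypothesis ptr_f : forall i j : 'I_(size s),
  ((tnth (in_tuple t) (f j)).2 == Some (f i : nat)) =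
  ((tnth (in_tuple s) j).2 == Some (i : nat)).

Lemma odd_transfer (i : 'I_(size s)) : odd (f i) = odd i.
Proof.
rewrite -(play_pos pt (onth_tnth (f i))) -(play_pos ps (onth_tnth i)).
by rewrite label_f.
Qed.

Lemma pointers_transfer (i : 'I_(size s)) : pointers t (f i) = pointers s i.
Proof.
rewrite !pointers_sum (reindex f) /=; last exact: onW_bij.
by apply: eq_bigr => j _; rewrite ptr_f.
Qed.

Hypothesis sat_s : forall i, odd i -> i < size s ->
  pointers s i = n - (depth s i).+1./2.
Hypothesis bound_s : forall i, odd i -> i < size s -> depth s i < n.*2.
Hypothesis bound_t : forall i, odd i -> i < size t -> depth t i < n.*2.

(** Through [f] both plays arrange the same Player moves with the same branching numbers, and
    saturation makes [s] the greedy arrangement of [levels_eq]. *)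
Lemma odd_depth_transfer : forall i : 'I_(size s), odd i ->
  depth t (f i) = depth s i.
Proof.
pose Y d := [set i : 'I_(size s) | f i \in low t d].
have inY d (i : 'I_(size s)) : (i \in Y d) = odd i && (depth t (f i) < d.*2).
  by rewrite !inE odd_transfer.
have cardY d : #|Y d| = #|low t d|.
  rewrite -(card_imset _ (bij_inj bij_f)); apply: eq_card => j.
  have [g fK gK] := bij_f; apply/imsetP/idP => [[i]|jt].
    by rewrite !inE => h ->.
  by exists (g j); rewrite ?inE gK //; move: jt; rewrite inE.
(* The factor [odd i] gives Opponent moves weight [0], which keeps them out of every level
   [d < n]. *)
pose w (i : 'I_(size s)) : nat := odd i * pointers s i.
have wE (i : 'I_(size s)) : odd i -> w i = pointers s i.
  by rewrite /w => ->; rewrite mul1n.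
have eqXY d : d < n -> low s d = Y d.
  apply: (@levels_eq _ w _ _ n).
  - by apply/setP => j; rewrite !inE andbF.
  - by apply/setP => j; rewrite !inE andbF.
  - move=> e; rewrite card_low //; congr _.+1; apply: eq_bigr => j.
    by rewrite inE => /andP[odd_j _]; rewrite wE.
  - move=> e; rewrite cardY card_low //; congr _.+1.
    rewrite (reindex f) /=; last exact: onW_bij.
    apply: eq_big => [j|j]; first by rewrite !inE.
    by rewrite inE odd_transfer pointers_transfer => /andP[odd_j _]; rewrite wE.
  (* By saturation [n - e <= w j] means [(depth s j).+1./2 <= e], which for an odd depth says
     [depth s j < e.*2]. *)
  - move=> e j lt_e; rewrite inE /w; case odd_j: (odd j) => /=; last by lia.
    have := depth_odd ps vs (ltn_ord j); rewrite sat_s // odd_j mul1n.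
    by have := bound_s odd_j (ltn_ord j); lia.
  - apply: eq_card => j; rewrite inY inE; case odd_j: (odd j) => //=.
    by rewrite bound_s // bound_t // odd_transfer.
move=> i odd_i.
have eq_lt d : d <= n -> (depth s i < d.*2) = (depth t (f i) < d.*2).
  rewrite leq_eqVlt => /predU1P[->|/eqXY e].
    by rewrite bound_s // bound_t // odd_transfer.
  by have := inY d i; rewrite -e inE odd_i.
have oddt : odd (depth t (f i)) by rewrite depth_odd // odd_transfer.
have odds : odd (depth s i) by rewrite depth_odd.
have bs := bound_s odd_i (ltn_ord i).
have bt : depth t (f i) < n.*2 by rewrite bound_t ?odd_transfer.
(* Comparing at the level of [i] in [s], then at its level in [t], gives the two inequalities
   between the depths. *)
have h1 := eq_lt (depth s i).+1./2; have h2 := eq_lt (depth t (f i)).+1./2.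
lia.
Qed.

Lemma ptr_transfer (i : 'I_(size s)) a p (lt_p : p < size s) :
  onth s i = Some (a, Some p) ->
  onth t (f i) = Some (a, Some (f (Ordinal lt_p) : nat)).
Proof.
rewrite !onth_tnth => -[ei]; have := ptr_f (Ordinal lt_p) i.
have := label_f i; rewrite ei /= eqxx => la /eqP lp.
by rewrite [tnth _ _]surjective_pairing la lp.
Qed.

Lemma root_transfer (i : 'I_(size s)) a :
  onth s i = Some (a, None) -> onth t (f i) = Some (a, None).
Proof.
move=> si; have mina := play_init ps si.
have e : (tnth (in_tuple t) (f i)).1 = a.
  by rewrite label_f; move: si; rewrite onth_tnth => -[->].
rewrite onth_tnth [tnth _ _]surjective_pairing e; congr (Some (_, _)).
by apply/(play_minimal pt (onth_tnth _)); rewrite e.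
Qed.

(** An Opponent move is the root or lies one step below its target, a Player move. *)
Lemma depth_transfer (i : 'I_(size s)) : depth t (f i) = depth s i.
Proof.
have [odd_i|even_i] := boolP (odd i); first exact: odd_depth_transfer.
case si: (onth s i) => [[a [p|]]|]; last by rewrite onth_tnth in si.
  have lt_p : p < size s by have [_ [m [/onth_lt]]] := play_ptr ps si.
  rewrite (depthS pt vt (ptr_transfer lt_p si)) (depthS ps vs si) odd_transfer.
  by rewrite (negbTE even_i) odd_depth_transfer //= (play_ptr_odd ps si).
by rewrite (depth_root ps vs si) (depth_root pt vt (root_transfer si)).
Qed.

Lemma annot_transfer (i : 'I_(size s)) : annot t (f i) = annot s i.
Proof.
rewrite /annot; case si: (onth s i) => [[a [p|]]|].
- have lt_p : p < size s by have [_ [m [/onth_lt]]] := play_ptr ps si.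
  by rewrite (ptr_transfer lt_p si) /= depth_transfer.
- by rewrite (root_transfer si).
- by rewrite onth_tnth in si.
Qed.

Lemma follows_transfer : follows v s -> follows v t.
Proof.
move=> fol j lt_j; have [g _ gK] := bij_f.
have -> : j = f (g (Ordinal lt_j)) by rewrite gK.
by rewrite depth_transfer annot_transfer fol.
Qed.

End Transfer.

(** * From saturated plays back to P-views *)

(** A Player move at depth [d.*2.+1] has [n - d.+1] moves pointing to it, a positive number while
    [d.+1 < n]; the answer to any of them lies two steps deeper. *)
Lemma saturated_depth s n d : is_play s -> viewable s -> ~~ odd (size s) ->
  0 < size s ->
  (forall i, odd i -> i < size s -> pointers s i = n - (depth s i).+1./2) ->
  d < n -> exists i, [/\ odd i, i < size s & depth s i = d.*2.+1].
Proof.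
move=> ps vs even_s s_gt0 sat; elim: d => [|d IH] lt_d.
  have [a s0] := play_root ps s_gt0.
  have lt_1 : 1 < size s by case: (size s) even_s s_gt0 => [|[]].
  exists 1; split=> //.
  by rewrite (depth_succ ps vs) // (depth_root ps vs s0).
have [i [odd_i lt_i di]] := IH (ltnW lt_d).
have [j [a sj]] : exists j a, onth s j = Some (a, Some i).
  by apply: pointers_has; rewrite sat // di; lia.
have even_j : ~~ odd j by rewrite -(play_ptr_odd ps sj).
have lt_j : j.+1 < size s.
  rewrite ltn_neqAle (onth_lt sj) andbT; apply: contra even_s => /eqP <-.
  by rewrite /= even_j.
exists j.+1; split=> //.
by rewrite (depth_succ ps vs) // (depthS ps vs sj) (negbTE even_j) di doubleS.
Qed.

(** The prefix ending at the Player move [j] has even length, so it is again a play of [sigma], and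
    [w] is its P-view. *)
Lemma pviews_depth sigma t j : innocent sigma -> plays sigma t ->
  odd j -> j < size t ->
  exists w, [/\ pviews sigma w, size w = (depth t j).+1 &
    forall v, follows v t -> w = take (depth t j).+1 v].
Proof.
move=> inn st odd_j lt_j; have pt := strategy_play st.
have [o vo] := innocent_view inn st lt_j.
have [o' e] := view_last vo; rewrite e in vo.
exists (extract t (rcons o' j)).
rewrite (size_extract pt vo) (depth_view pt vo) size_rcons; split=> //.
- exists (take j.+1 t).
    apply: (@strategy_prefix _ _ _ (drop j.+1 t)); last first.
      by rewrite cat_take_drop.
    by rewrite size_takel //= odd_j.
  have lt_o : size o' < size (rcons o' j) by rewrite size_rcons.
  have := pview_take pt vo lt_o; rewrite nth_rcons ltnn eqxx.
  rewrite (take_oversize (n := (size o').+1)) //.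
  by rewrite (size_extract pt vo) size_rcons.
- by move=> v fol; rewrite (follows_extract pt fol vo) size_rcons.
Qed.

Lemma rooted_well_opened s :
  is_play s -> rooted s -> 0 < size s -> well_opened s.
Proof.
move=> ps rs s_gt0; have [a s0] := play_root ps s_gt0.
exists 0; split; first by exists (a, None); split=> //; exact: play_init s0.
move=> i [[b q] [si /(play_minimal ps si) /= e]].
by rewrite e in si; rewrite (rs _ _ si).
Qed.

Lemma well_opened_rooted s :
  is_play s -> well_opened s -> rooted s /\ 0 < size s.
Proof.
move=> ps [r [[m [sr minm]] uniq_r]].
have s_gt0 : 0 < size s by apply: leq_ltn_trans (onth_lt sr).
split=> // i b si; have [a s0] := play_root ps s_gt0.
rewrite -(uniq_r i); last by exists (b, None); split=> //; exact: play_init si.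
by apply: uniq_r; exists (a, None); split=> //; exact: play_init s0.
Qed.

Lemma config_iso_refl (x : config A) : config_iso x x.
Proof. by exists id; split=> //; exists id. Qed.

Lemma pviews_transfer sigma1 sigma2 v : innocent sigma1 -> innocent sigma2 ->
  Pos sigma1 = Pos sigma2 -> pviews sigma1 v ->
  (forall w, pviews sigma2 w -> size w <= size v) -> pviews sigma2 v.
Proof.
move=> inn1 inn2 eq_pos v1 bound.
have [n sz] : exists n, size v = n.*2.
  case: v1 => s ss [o vo ->]; have ps := strategy_play ss.
  exists (size o)./2; rewrite (size_extract ps vo).
  by rewrite even_halfK // (view_odd ps vo); exact: strategy_even ss.
have [n0|n_gt0] := posnP n.
  rewrite n0 in sz; rewrite (size0nil sz).
  have [s ss] := strategy_nonempty sigma2; exists [::].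
    exact: (@strategy_prefix _ sigma2 [::] s).
  by exists [::] => //; exact: view_nil.
have [s [ss rs s_gt0 fol sat]] := saturated_play inn1 v1 sz n_gt0.
have ps := strategy_play ss; have wos := rooted_well_opened ps rs s_gt0.
have : Pos sigma1 (position (deseq (strategy_play ss) wos)).
  by exists s, ss, wos.
rewrite eq_pos => -[t [st [wot e]]].
have pt := strategy_play st; have [rt t_gt0] := well_opened_rooted pt wot.
have vs := innocent_view inn1 ss; have vt := innocent_view inn2 st.
have even_s := strategy_even ss; have even_t := strategy_even st.
(* [e] equates two predicates, so reflexivity at the configuration of [t] becomes an isomorphism
   from that of [s]. *)
have [f [bij_f label_f covers_f]] : config_iso (deseq (strategy_play ss) wos)
    (deseq (strategy_play st) wot).
  have := config_iso_refl (deseq (strategy_play st) wot).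
  by rewrite -/(position _ _) -e.
have points_f (i j : 'I_(size s)) :
    @points_to _ t (f j) (f i) = @points_to _ s j i.
  apply/idP/idP => [/(covers_points_to _ _ pt)/covers_f|].
    by move/(covers_points_to _ _ ps).
  by move/(covers_points_to _ _ ps)/covers_f/(covers_points_to _ _ pt).
have pointsE (u : pstring A) (i j : 'I_(size u)) : is_play u ->
    @points_to _ u j i = ((tnth (in_tuple u) j).2 == Some (i : nat)).
  move=> pu; rewrite /points_to; case: eqP => //= ej.
  have := onth_tnth j; case: (tnth _ j) ej => a q /= -> uj.
  by have [-> _] := play_ptr pu uj.
have ptr_f (i j : 'I_(size s)) :
  ((tnth (in_tuple t) (f j)).2 == Some (nat_of_ord (f i))) =
  ((tnth (in_tuple s) j).2 == Some (nat_of_ord i)).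
  by rewrite -!pointsE // points_f.
have lt_s i : i < size s -> depth s i < size v.
  move=> lt_i; rewrite -onthTE fol // /annot.
  by have [m ->] := onth_some lt_i.
have bound_s i : odd i -> i < size s -> depth s i < n.*2.
  by move=> _; rewrite -sz; exact: lt_s.
(* The length hypothesis on [sigma2] enters here: the branches of [t] are P-views of [sigma2]. *)
have bound_t j : odd j -> j < size t -> depth t j < n.*2.
  move=> odd_j lt_j; have [w [sw <- _]] := pviews_depth inn2 st odd_j lt_j.
  by rewrite -sz; exact: bound.
have depth_f := depth_transfer ps pt vs vt even_s even_t rs rt s_gt0 t_gt0 bij_f
  label_f ptr_f sat bound_s bound_t.
have fol_t := follows_transfer ps pt vs vt even_s even_t rs rt s_gt0 t_gt0 bij_f
  label_f ptr_f sat bound_s bound_t fol.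
(* Depth [n.-1.*2.+1] is that of the last move of [v], so the branch of [t] found there is all of
   [v]. *)
have lt_n : n.-1 < n by rewrite prednK.
have [i [odd_i lt_i di]] := saturated_depth ps vs even_s s_gt0 sat lt_n.
have odd_fi : odd (f (Ordinal lt_i)) by rewrite (odd_transfer ps pt label_f).
have [w [w2 _ ew]] := pviews_depth inn2 st odd_fi (ltn_ord _).
move: w2; rewrite (ew _ fol_t) depth_f /= di -doubleS prednK //.
by rewrite take_oversize ?sz.
Qed.
End Views.

Theorem theorem40 (A : arena) (sigma1 sigma2 : strategy A)
    (inn1 : innocent sigma1) (inn2 : innocent sigma2)
    (fin1 : finite_strategy sigma1) (fin2 : finite_strategy sigma2)
    (eq_pos : Pos sigma1 = Pos sigma2) :
  longest_pviews sigma1 = longest_pviews sigma2.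
Proof.
suff incl (sigma tau : strategy A) : innocent sigma -> innocent tau ->
    Pos sigma = Pos tau ->
    (longest_pviews sigma `<=` longest_pviews tau)%classic.
  by apply/seteqP; split; apply: incl.
move=> inn_s inn_t eq_st v [sv long_v].
(* A P-view [w] of [tau] longer than [v] exceeds all P-views of [sigma], so the transfer in the
   other direction puts [w] in [sigma], against the maximality of [v]. *)
have bound w : pviews tau w -> size w <= size v.
  move=> tw; rewrite leqNgt; apply/negP => lt_vw.
  have sw : pviews sigma w.
    apply: (pviews_transfer inn_t inn_s _ tw) => // u su.
    exact: leq_trans (long_v _ su) (ltnW lt_vw).
  by have := long_v _ sw; rewrite leqNgt lt_vw.
by split; first exact: pviews_transfer eq_st sv bound.
Qed.
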